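(* Let $\pi\in B_n$, and let $\pi=u_1\cdot v_1\cdot u_2\cdot v_2\cdots v_{r-1}\cdot u_r$ be its $uv$-presentation (defined in the context). Then $$\ell(\pi)=\ell(u_r)+\ell(v_{r-1})-\ell(u_{r-1})-\ell(v_{r-2})+\ell(u_{r-2})+\ell(v_{r-3})-\cdots+(-1)^{r-1}\ell(u_1),$$ that is, $$\ell(\pi)=\sum_{j=1}^{r}(-1)^{r-j}\,\ell(u_j)+\sum_{j=1}^{r-1}(-1)^{r-1-j}\,\ell(v_j).$$
   Context: $B_n$ is the group of signed permutations, i.e. the bijections $\pi$ of $\{\pm1,\dots,\pm n\}$ with $\pi(-i)=-\pi(i)$. It is a Coxeter group with generators $s_0,\dots,s_{n-1}$, where $s_0$ exchanges $1$ and $-1$, and for $1\le i\le n-1$, $s_i$ exchanges $i$ with $i+1$ and $-i$ with $-(i+1)$; $\ell$ is the Coxeter length with respect to these generators. Products are read from left to right: $(\pi_1\cdot\pi_2)(i)=\pi_2(\pi_1(i))$. $\dot S_n$ is the subgroup generated by $s_1,\dots,s_{n-1}$. For $1\le k\le n$, $\tau_k=s_0s_1\cdots s_{k-1}$. Every element of $B_n$ has a unique presentation $\tau_1^{i_1}\cdots\tau_n^{i_n}$ with integers $-k\le i_k<k$, called its generalized standard $OGS$ presentation; it is written omitting trivial factors, with strictly increasing subscripts. The $uv$-presentation: every $\pi\in B_n$ has a unique presentation $\pi=u_1\cdot v_1\cdot u_2\cdot v_2\cdots v_{r-1}\cdot u_r$, for some $r\ge1$, such that: $u_j\in\dot S_n$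 for $1\le j\le r$; $v_j=\tau_{p_j}^{p_j}$ for $1\le j\le r-1$ with $p_1<p_2<\dots<p_{r-1}$; and for each $1\le j\le r$, either $u_j=1$ or the generalized standard $OGS$ presentation of $u_j$ has smallest subscript $\ge p_{j-1}$ (when $j\ge2$) and largest subscript $\le p_j$ (when $j\le r-1$). *)

(* Defs.v *)
From mathcomp Require Export all_boot all_order all_fingroup all_algebra.

Set Implicit Arguments.
Unset Strict Implicit.
Unset Printing Implicit Defensive.

Import Order.TTheory GRing.Theory Num.Theory GroupScope.

(* Integer powers in a finite group: the library only has x ^+ n and x ^- n
   for n : nat. *)
Definition expgz (gT : finGroupType) (x : gT) (m : int) : gT :=
  match m with Posz k => x ^+ k | Negz k => x ^- k.+1 end.

(* Least k such that x is a product of k elements of S; here S ^+ k is the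
   k-fold product of sets, with S ^+ 0 = 1.  Searching k < #|gT| suffices when
   x \in <<S>>, see word_lengthP; otherwise the value is the dummy #|gT|. *)
Definition word_length (gT : finGroupType) (S : {set gT}) (x : gT) : nat :=
  find (fun k => x \in S ^+ k) (iota 0 #|gT|).

Lemma expgsP (gT : finGroupType) (S : {set gT}) k x :
  reflect (exists w : seq gT,
             [/\ size w = k, all (mem S) w & x = \prod_(y <- w) y])
          (x \in S ^+ k).
Proof.
apply: (iffP idP).
  elim: k x => [|k IHk] x; first by move=> /set1gP->; exists [::]; rewrite big_nil.
  rewrite expgS => /mulsgP[y z Sy /IHk[w [<- Sw ->]] ->].
  by exists (y :: w); rewrite /= Sy Sw big_cons.
elim: k x => [|k IHk] x [[|y w] [//= szw]].
  by rewrite big_nil => _ ->; exact: set11.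
case/andP=> Sy Sw ->; rewrite big_cons expgS mem_mulg //.
by apply: IHk; exists w; case: szw.
Qed.

Lemma word_lengthP (gT : finGroupType) (S : {set gT}) (x : gT) :
  x \in <<S>> ->
  x \in S ^+ word_length S x /\
  (forall k, x \in S ^+ k -> word_length S x <= k).
Proof.
case/gen_prodgP=> n [c Sc def_x].
have exk : exists k, x \in S ^+ k.
  exists n; apply/expgsP; exists [seq c i | i <- index_enum 'I_n].
  split; last by rewrite big_map.
    by rewrite size_map [index_enum _]unlock -enumT size_enum_ord.
  by apply/allP=> _ /mapP[i _ ->]; apply: Sc.
case: (ex_minnP exk) => m /expgsP[w [szw Sw def_xw]] min_m.
pose pre (i : 'I_m.+1) := \prod_(y <- take i w) y.
have neq_pre (i j : 'I_m.+1) : i < j -> pre i <> pre j.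
  move=> ltij eq_pre; have lejm : j <= m by rewrite -ltnS.
  suff /min_m: x \in S ^+ (i + (m - j)).
    by rewrite -{1}(subnKC lejm) leq_add2r leqNgt ltij.
  apply/expgsP; exists (take i w ++ drop j w); split.
  - rewrite size_cat size_drop size_takel szw //.
    by rewrite (leq_trans (ltnW ltij)).
  - move/allP: Sw => Sw; rewrite all_cat.
    by apply/andP; split; apply/allP=> y; [move/mem_take | move/mem_drop]; apply: Sw.
  - by rewrite big_cat /= -/(pre i) eq_pre -big_cat /= cat_take_drop.
have lt_m : m < #|gT|.
  have pre_inj : injective pre.
    move=> i j eqij; apply/val_inj.
    by case: (ltngtP i j) => // /neq_pre; rewrite eqij.
  by have := leq_card pre pre_inj; rewrite card_ord.
have Pm : x \in S ^+ m by apply/expgsP; exists w.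
have has_m : has (fun k => x \in S ^+ k) (iota 0 #|gT|).
  by apply/hasP; exists m; rewrite ?mem_iota.
have lt_find : word_length S x < #|gT|.
  by move: has_m; rewrite has_find size_iota.
split; first by have := nth_find 0 has_m; rewrite nth_iota.
move=> k /min_m; apply: leq_trans; rewrite leqNgt; apply/negP=> lt_mk.
by have := before_find 0 lt_mk; rewrite nth_iota //= add0n Pm.
Qed.

(* {+-1, ..., +-n}: (b, i) stands for (-1)^b (i + 1). *)
Definition spoint (n : nat) : finType := (bool * 'I_n)%type.

Definition sopp (n : nat) (x : spoint n) : spoint n := (~~ x.1, x.2).

(* The library product of permutations is (s * t) x = t (s x), that is,
   products are read from left to right. *)
Definition signed_perms (n : nat) : {set {perm spoint n}} :=
  [set s : {perm spoint n} | [forall x, s (sopp x) == sopp (s x)]].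

(* For i > 0, the 0-based position i encodes the letter i + 1 and ord_pred i
   encodes the letter i. *)
Definition cox_gen (n : nat) (i : 'I_n) : {perm spoint n} :=
  if i == 0 :> nat then tperm (false, i) (true, i)
  else tperm (false, ord_pred i) (false, i) * tperm (true, ord_pred i) (true, i).

Definition cox_length (n : nat) (s : {perm spoint n}) : nat :=
  word_length [set cox_gen i | i : 'I_n] s.

Definition dotS (n : nat) : {set {perm spoint n}} :=
  <<[set cox_gen i | i : 'I_n & 0 < i]>>.

(* tau_k = s_0 s_1 ... s_(k-1), meaningful for 1 <= k <= n. *)
Definition tau (n k : nat) : {perm spoint n} :=
  \prod_(i < n | i < k) cox_gen i.

(* Exponents are indexed by 'I_n, so that e k is the exponent of tau_(k+1). *)
Definition is_OGS (n : nat) (s : {perm spoint n}) (e : 'I_n -> int) : Prop :=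
  (forall k : 'I_n, (- (k.+1%:Z) <= e k < k.+1%:Z)%R) /\
  s = \prod_(k < n) expgz (tau n k.+1) (e k).

Definition OGS_subscript (n : nat) (e : 'I_n -> int) (m : nat) : Prop :=
  exists k : 'I_n, m = k.+1 /\ e k <> 0%R.

(* The families u, v, p are indexed from 1; only u_1, ..., u_r and
   v_1, ..., v_(r-1), p_1, ..., p_(r-1) are relevant. *)
Definition is_uv_presentation (n : nat) (s : {perm spoint n}) (r : nat)
    (u v : nat -> {perm spoint n}) (p : nat -> nat) : Prop :=
  [/\ 1 <= r,
      s = (\prod_(1 <= j < r) (u j * v j)) * u r,
      (forall j, 1 <= j <= r -> u j \in dotS n),
      (forall j, 1 <= j < r -> 1 <= p j <= n /\ v j = tau n (p j) ^+ p j) /\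
      (forall i j, 1 <= i -> i < j -> j < r -> p i < p j)
    & forall j, 1 <= j <= r ->
        u j = 1 \/
        exists2 e : 'I_n -> int, is_OGS (u j) e &
          forall m, OGS_subscript e m ->
            (2 <= j -> p j.-1 <= m) /\ (j < r -> m <= p j)].

(* Main.v *)
(* Put s = u_1 v_1 ... u_(r-1), p = p_(r-1), v = v_(r-1) and u = u_r, so that
   pi = s v u.  All factors of s live in B_p and v is the longest element of B_p,
   hence l(s v) = l(v) - l(s).  The signed permutation u has no tau_k with k < p
   in its presentation; since the other tau_k rotate a cyclic order, and since u
   preserves signs, u is increasing on {-p, ..., p}, that is, a minimal coset
   representative of B_p.  Hence l(s v u) = l(s v) + l(u), so that
   l(pi) = l(u) + l(v) - l(s), and one concludes by induction on r. *)
Require Import Defs.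
From mathcomp Require Import zify ring.
Import GRing.Theory Num.Theory.

Set Implicit Arguments.
Unset Strict Implicit.
Unset Printing Implicit Defensive.

Local Open Scope nat_scope.

(** * Action of the Coxeter generators on signed letters *)

Section SignedPoints.
Variable n : nat.
Implicit Types (s t : {perm spoint n}) (x y : spoint n) (i : 'I_n).

Lemma spointP x y : x.1 = y.1 -> x.2 = y.2 :> nat -> x = y.
Proof. by case: x y => [b i] [c j] /= -> /val_inj ->. Qed.

Lemma val_ord_pred i : (0 < i)%N -> ord_pred i = i.-1 :> nat.
Proof.
case: i => [[|i] lt_in] //= _.
by rewrite /= modnDr modn_small // ltnW.
Qed.

(** Sign and position are treated separately, the position as a natural number, so that later case
    analyses reduce to linear arithmetic. *)
Lemma cox_gen1 i x : (cox_gen i x).1 = x.1 (+) ((i == 0 :> nat) && (x.2 == 0 :> nat)).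
Proof.
case: x => b j; rewrite /cox_gen; case: eqP => [i0|/eqP i0] /=; last first.
  rewrite addbF permM; case: (tpermP _ _ (b, j)) => [[-> _]|[-> _]|_ _];
  by case: tpermP => [[]|[]|].
have -> : (j == 0 :> nat) = (j == i) by rewrite -val_eqE /= i0.
case: tpermP => [[-> ->]|[-> ->]|ne1 ne2] /=; rewrite ?eqxx ?addbT ?addbF //.
case: (j =P i) => [ji|_]; last by rewrite addbF.
by move: ne1 ne2; rewrite ji; case: (b).
Qed.

Lemma cox_gen2 i x : (cox_gen i x).2 =
  (if i == 0 :> nat then x.2 : nat else if x.2 == i :> nat then i.-1
   else if x.2 == i.-1 :> nat then (i : nat) else x.2) :> nat.
Proof.
case: x => b j; rewrite /cox_gen; case: eqP => [i0|/eqP i0] /=.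
  by case: tpermP => [[_ ->]|[_ ->]|].
have i_gt0 : (0 < i)%N by rewrite lt0n.
have pE := val_ord_pred i_gt0.
have neq : ord_pred i != i by apply/eqP => /(congr1 (@nat_of_ord n)); rewrite pE; lia.
rewrite -pE; move: (ord_pred i) neq {pE} => k neq.
rewrite permM; case: (tpermP _ _ (b, j)) => [[_ ->]|[_ ->]|ne1 ne2] /=.
- by rewrite val_eqE (negPf neq) eqxx tpermD.
- by rewrite eqxx tpermD.
case: tpermP => [[_ ->]|[_ ->]|ne3 ne4] /=; rewrite ?eqxx ?val_eqE ?(negPf neq) //.
case: eqP => [ji|_]; first by move: ne2 ne4; rewrite ji; case: (b).
by case: eqP => [ji|//]; move: ne1 ne3; rewrite ji; case: (b).
Qed.

Lemma signed_permP s :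
  reflect (forall x, s (sopp x) = sopp (s x)) (s \in signed_perms n).
Proof. by rewrite inE; apply: (iffP forallP) => H x; apply/eqP. Qed.

Lemma signed_perm1 : 1%g \in signed_perms n.
Proof. by apply/signed_permP => x; rewrite !perm1. Qed.

Lemma signed_permM s t :
  s \in signed_perms n -> t \in signed_perms n -> (s * t)%g \in signed_perms n.
Proof.
by move=> /signed_permP Ss /signed_permP St; apply/signed_permP => x;
  rewrite !permM Ss St.
Qed.

Lemma cox_gen_signed i : cox_gen i \in signed_perms n.
Proof.
apply/signed_permP => x; apply: spointP; rewrite /= ?cox_gen1 ?cox_gen2 //=.
by rewrite addNb.
Qed.

Lemma cox_genK i : (cox_gen i * cox_gen i = 1)%g.
Proof.
apply/permP => x; rewrite permM perm1; apply: spointP.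
  by rewrite !cox_gen1 cox_gen2; case: (i == 0 :> nat); case: (x.1); case: (x.2 == 0 :> nat).
have := ltn_ord x.2; have := ltn_ord i.
rewrite !cox_gen2; move: (nat_of_ord x.2) (nat_of_ord i) => j k.
by case: (k =P 0) => ?; case: (j =P k) => ?; case: (j =P k.-1) => ? *;
  do ?case: eqP => ?; lia.
Qed.

(** * Coxeter length as a weighted count of inversions *)

Definition slt x y : bool :=
  match x.1, y.1 with
  | true, false => true
  | false, true => false
  | false, false => (x.2 < y.2)%N
  | true, true => (y.2 < x.2)%N
  end.

Definition flip s x y : bool := slt x y (+) slt (s x) (s y).

Definition pair_weight (z : spoint n * spoint n) : nat := (z.1.2 == z.2.2).+1.

(* Each positive root of B_n accounts for 4 here: it is a pair {x, y} together
   with its negative {-x, -y}, every pair counted in both orders; the pairs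
   {x, -x} are their own negatives, hence get weight 2. *)
Definition inv4 s : nat := \sum_z pair_weight z * flip s z.1 z.2.

Lemma signed_perm_abs s x y :
  s \in signed_perms n -> ((s x).2 == (s y).2) = (x.2 == y.2).
Proof.
move=> /signed_permP Ss.
have absE (a b : spoint n) : (a.2 == b.2) = (a == b) || (a == sopp b).
  case: a b => [a i] [b j]; rewrite /sopp !xpair_eqE /=.
  by case: a; case: b; rewrite //= orbF.
by rewrite !absE -Ss !(inj_eq perm_inj).
Qed.

(** [flip] is a cocycle: [flip (s * t) x y] is the exclusive or of [flip s x y] and
    [flip t (s x) (s y)]. The correction sum counts the inversions of [s] undone by [t]. Reindexing
    by [s] keeps the weights, because [s] commutes with negation. *)
Lemma inv4M s t : s \in signed_perms n ->
  (inv4 (s * t) +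
     2 * \sum_z pair_weight z * (flip s z.1 z.2 && flip t (s z.1) (s z.2)) =
   inv4 s + inv4 t)%N.
Proof.
move=> Ss.
have -> : inv4 t = \sum_z pair_weight z * flip t (s z.1) (s z.2).
  rewrite /inv4 (reindex (fun z => (s z.1, s z.2))) /=; last first.
    exists (fun z => (s^-1 z.1, s^-1 z.2)%g) => [] [x y] _ /=; by rewrite ?permK ?permKV.
  by apply: eq_bigr => z _; rewrite /pair_weight /= (signed_perm_abs _ _ Ss).
rewrite big_distrr -!big_split; apply: eq_bigr => z _ /=.
rewrite /flip !permM.
by case: (slt z.1 z.2); case: (slt (s z.1) _); case: (slt (t _) _) => /=; lia.
Qed.

(** A generator exchanges letters that are neighbours in the order [slt], hence reverses no pair
    other than those it exchanges. *)
Lemma flip_cox_gen i x y :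
  flip (cox_gen i) x y = (y == cox_gen i x) && (cox_gen i x != x).
Proof.
have -> : (y == cox_gen i x) = (y.1 == (cox_gen i x).1) && (y.2 == (cox_gen i x).2 :> nat).
  by case: y (cox_gen i x) => [b j] [c k].
have -> : (cox_gen i x == x) = ((cox_gen i x).1 == x.1) && ((cox_gen i x).2 == x.2 :> nat).
  by case: x (cox_gen i _) => [b j] [c k].
rewrite /flip /slt !cox_gen1 !cox_gen2.
case: x y => [[] j] [[] k] /=; do !case: eqP => ? //=; lia.
Qed.

Lemma neq_cox_gen i x :
  (cox_gen i x != x) = (x.2 == i :> nat) || (x.2 == i.-1 :> nat).
Proof.
have -> : (cox_gen i x == x) = ((cox_gen i x).1 == x.1) && ((cox_gen i x).2 == x.2 :> nat).
  by case: x (cox_gen i _) => [b j] [c k].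
rewrite !cox_gen1 !cox_gen2; move: (nat_of_ord x.2) (nat_of_ord i) => j k.
by case: (k =P 0) => ?; case: (j =P k) => ?; case: (j =P k.-1) => ?;
  case: (x.1) => /=; lia.
Qed.

(** For [i = 0] both terms on the right test position 0, since [0.-1 = 0]; their sum 2 is then the
    weight of the pair of x and -x. *)
Lemma pair_weight_cox_gen i x :
  pair_weight (x, cox_gen i x) * (cox_gen i x != x) =
  (x.2 == i :> nat) + (x.2 == i.-1 :> nat).
Proof.
rewrite neq_cox_gen /pair_weight /= -val_eqE /= cox_gen2.
move: (nat_of_ord x.2) (nat_of_ord i) => j k.
by case: (k =P 0) => ?; case: (j =P k) => ?; case: (j =P k.-1) => ? /=;
  try case: eqP => ? /=; lia.
Qed.

Lemma inv4_cox_gen i : inv4 (cox_gen i) = 4.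
Proof.
have lt_i1 : i.-1 < n by rewrite (leq_ltn_trans (leq_pred i)).
rewrite /inv4.
rewrite -(pair_bigA _ (fun x y : spoint n => pair_weight (x, y) * flip (cox_gen i) x y)) /=.
transitivity (\sum_(x : spoint n) ((x.2 == i) + (x.2 == Ordinal lt_i1))).
  apply: eq_bigr => x _; rewrite (bigD1 (cox_gen i x)) //= big1 => [|y ne].
    by rewrite flip_cox_gen eqxx addn0 pair_weight_cox_gen.
  by rewrite flip_cox_gen (negPf ne) muln0.
rewrite -(pair_bigA _ (fun (b : bool) j => (j == i) + (j == Ordinal lt_i1))) /=.
by rewrite big_bool /= big_split /= -!big_mkcond !sum1_card !card1.
Qed.

Lemma inv4_cox_genM_le i s : inv4 (cox_gen i * s) <= 4 + inv4 s.
Proof. by rewrite -(inv4_cox_gen i) -inv4M ?cox_gen_signed ?leq_addr. Qed.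

(** At a descent, [s] undoes every inversion of the generator, so the correction sum of [inv4M]
    equals [inv4 (cox_gen i) = 4]. *)
Lemma inv4_cox_genM_descent i s :
  (forall x, cox_gen i x != x -> flip s (cox_gen i x) x) ->
  inv4 (cox_gen i * s) + 4 = inv4 s.
Proof.
move=> desc; have := inv4M s (cox_gen_signed i).
rewrite (eq_bigr (fun z => pair_weight z * flip (cox_gen i) z.1 z.2)); last first.
  move=> [x y] _ /=; congr (_ * nat_of_bool _); rewrite flip_cox_gen.
  case: (y =P cox_gen i x) => [->|] //=; case: (boolP (_ != x)) => //= ne.
  by have /permP/(_ x) := cox_genK i; rewrite permM perm1 => ->; apply: desc.
rewrite -/(inv4 (cox_gen i)) inv4_cox_gen; lia.
Qed.

Lemma slt_sopp x y : slt (sopp x) (sopp y) = slt y x.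
Proof. by case: x y => [[] i] [[] j]. Qed.

Lemma sltxx x : slt x x = false.
Proof. by case: x => [[] i]; rewrite /slt /= ltnn. Qed.

Lemma slt_neq x y : x != y -> slt y x = ~~ slt x y.
Proof.
by case: x y => [[] i] [[] j]; rewrite /slt ?xpair_eqE -?val_eqE //= => ne; lia.
Qed.

Lemma flip_sym s x y : flip s x y = flip s y x.
Proof.
case: (eqVneq x y) => [->//|ne]; rewrite /flip (slt_neq ne).
by rewrite (@slt_neq (s x)) ?(inj_eq perm_inj) // addNb addbN negbK.
Qed.

Lemma flip_sopp s x y : s \in signed_perms n -> flip s (sopp x) (sopp y) = flip s x y.
Proof.
by move=> /signed_permP Ss; rewrite flip_sym /flip !Ss !slt_sopp.
Qed.

(** The pairs exchanged by a generator agree up to negation and order, neither of which affects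
    [flip]; hence one of them decides whether the generator is a descent. *)
Lemma flip_cox_gen_moved s i x : s \in signed_perms n -> cox_gen i x != x ->
  flip s (cox_gen i x) x = flip s (cox_gen i (false, i)) (false, i).
Proof.
move=> Ss; set y := (false, i).
have gg z : cox_gen i (cox_gen i z) = z.
  by have /permP/(_ z) := cox_genK i; rewrite permM perm1.
have /signed_permP gS := cox_gen_signed i.
rewrite neq_cox_gen => moved.
have [->|[->|[->|->]]] : x = y \/ x = sopp y \/ x = cox_gen i y \/ x = sopp (cox_gen i y);
  try by rewrite ?gS ?gg ?flip_sopp // flip_sym.
case/orP: moved => /eqP xi.
  by case: x xi => [[] j] /= /ord_inj ->; [right; left | left].
do 2!right; have g2 : (cox_gen i y).2 = i.-1 :> nat.
  by rewrite cox_gen2 /=; case: eqP => [->|]//; rewrite eqxx.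
case: (eqVneq x.1 (cox_gen i y).1) => b; [left | right]; apply: spointP; rewrite //= ?g2 //.
by case: (x.1) b; case: (_.1).
Qed.

(* If no generator is a descent, then s sends 1 < 2 < ... < n to a strictly
   increasing sequence of positive letters. *)
Lemma no_descent s : s \in signed_perms n ->
  (forall i, ~~ flip s (cox_gen i (false, i)) (false, i)) -> s = 1%g.
Proof.
move=> Ss noD; have /signed_permP Ssig := Ss.
have pos0 i : i = 0 :> nat -> ~~ (s (false, i)).1.
  move=> i0; have := noD i.
  have -> : cox_gen i (false, i) = sopp (false, i).
    by apply: spointP; rewrite /= ?cox_gen1 ?cox_gen2 i0.
  rewrite /flip Ssig; case: (s _) => [[] k] //.
have inc (i j : 'I_n) : j = i.+1 :> nat -> slt (s (false, i)) (s (false, j)).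
  move=> ji; have := noD j.
  have -> : cox_gen j (false, j) = (false, i).
    by apply: spointP; rewrite /= ?cox_gen1 ?cox_gen2 /= ji ?eqxx.
  by rewrite /flip {1}/slt /= ji ltnSn /= negbK.
have posle k (i : 'I_n) : k <= i -> forall j : 'I_n, j + k = i :> nat ->
    ~~ (s (false, j)).1 -> ~~ (s (false, i)).1 /\ (s (false, j)).2 + k <= (s (false, i)).2.
  elim: k i => [|k IHk] i le_ki j eq_i pos_j.
    have <- : j = i by [apply: ord_inj; rewrite -eq_i addn0].
    by rewrite addn0.
  have lt_i1 : i.-1 < n by rewrite (leq_ltn_trans (leq_pred i)).
  have [] := IHk (Ordinal lt_i1) _ j _ pos_j; rewrite /=; try lia.
  have := inc (Ordinal lt_i1) i; rewrite /slt /=.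
  have eq_i1 : i = i.-1.+1 :> nat by lia.
  case: (s (_, Ordinal _)) => [[] a]; case: (s (_, i)) => [[] b] //= /(_ eq_i1) //.
  move: (nat_of_ord (s (false, j)).2) => c lt_ab _ le_c; split=> //; lia.
have fix_pos (i : 'I_n) : s (false, i) = (false, i).
  have n_gt0 : 0 < n by rewrite (leq_ltn_trans _ (ltn_ord i)).
  have lt_n1 : n.-1 < n by rewrite prednK.
  (* Growth by at least one per step, counted from the first letter, bounds the image of [i] from
     below; counted up to the last letter, it bounds it from above. *)
  have [pos_i le_i] := posle i i (leqnn i) (Ordinal n_gt0) erefl (pos0 (Ordinal n_gt0) erefl).
  have lt_in := ltn_ord i.
  have [||_ ge_i] := posle (n.-1 - i) (Ordinal lt_n1) _ i _ pos_i; rewrite /=; try lia.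
  have lt_s := ltn_ord (s (false, Ordinal lt_n1)).2.
  apply: spointP => /=; first exact: negPf.
  rewrite /= in le_i ge_i lt_s; lia.
apply/permP => -[[] i]; rewrite perm1 //.
by have -> : (true, i) = sopp (false, i) by []; rewrite Ssig fix_pos.
Qed.

Lemma prod_signed (I : Type) (r : seq I) (P : pred I) (F : I -> {perm spoint n}) :
  (forall j, P j -> F j \in signed_perms n) ->
  (\prod_(i <- r | P i) F i)%g \in signed_perms n.
Proof.
move=> SF; apply: (big_ind (fun s => s \in signed_perms n)) => //.
- exact: signed_perm1.
- exact: signed_permM.
Qed.

(** Stripping a descent lowers [inv4] by 4, and by [no_descent] the process stops only at the
    identity. *)
Lemma signed_perm_gen s : s \in signed_perms n ->
  exists2 k, s \in ([set cox_gen i | i : 'I_n] ^+ k)%g & inv4 s = 4 * k.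
Proof.
have [m] := ubnP (inv4 s); elim: m s => // m IHm s lt_s Ss.
have [/existsP[i Di]|/existsPn noD] :=
  boolP [exists i, flip s (cox_gen i (false, i)) (false, i)]; last first.
  exists 0; rewrite (no_descent Ss noD) ?set11 //.
  by rewrite /inv4 big1 // => z _; rewrite /flip !perm1 addbb muln0.
have eq4 : inv4 (cox_gen i * s) + 4 = inv4 s.
  by apply: inv4_cox_genM_descent => x ne; rewrite flip_cox_gen_moved.
have [||k Sk eq_k] := IHm (cox_gen i * s)%g; first by lia.
  by rewrite signed_permM ?cox_gen_signed.
exists k.+1; last by lia.
have -> : s = (cox_gen i * (cox_gen i * s))%g by rewrite mulgA cox_genK mul1g.
by rewrite expgS mem_mulg // imset_f.
Qed.

(** The word from [signed_perm_gen] bounds the length from above. Conversely each letter of a word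
    adds at most 4 to [inv4]. *)
Lemma inv4_cox_length s : s \in signed_perms n -> inv4 s = 4 * cox_length s.
Proof.
move=> Ss; have [k Sk eq_k] := signed_perm_gen Ss.
have [|Sl min_l] := @word_lengthP _ [set cox_gen i | i : 'I_n] s.
  have /expgsP[w [_ /allP Sw ->]] := Sk.
  by rewrite big_seq; apply: group_prod => g /Sw; apply: mem_gen.
apply/eqP; rewrite /cox_length eqn_leq {2}eq_k leq_mul2l /= min_l // andbT.
have /expgsP[w [<- Sw {1}->]] := Sl.
elim: w Sw => [_|g w IHw /= /andP[/imsetP[i _ ->] /IHw le_w]].
  by rewrite big_nil /inv4 big1 // => z _; rewrite /flip !perm1 addbb muln0.
by rewrite big_cons mulnS (leq_trans (inv4_cox_genM_le _ _)) ?leq_add2l.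
Qed.

(** * Lengths of products with elements of the subgroup B_p *)

(** Positions are 0-based, so [p <= x.2] selects the letters of absolute value greater than p. For p
    at most n, the signed permutations with this property form B_p. *)
Definition fixes_above p s := forall x, p <= x.2 -> s x = x.

Definition increasing_below p s :=
  forall x y, x.2 < p -> y.2 < p -> slt (s x) (s y) = slt x y.

Lemma fixes_above_lt p s x : fixes_above p s -> ((s x).2 < p) = (x.2 < p).
Proof.
move=> fs; case: (ltnP x.2 p) => px; last by rewrite fs // ltnNge px.
by rewrite ltnNge; apply/negP => ps; have := px; rewrite -(perm_inj (fs _ ps)) ltnNge ps.
Qed.

Lemma fixes_above1 p : fixes_above p 1%g.
Proof. by move=> x _; rewrite perm1. Qed.

Lemma fixes_aboveM p s t : fixes_above p s -> fixes_above p t -> fixes_above p (s * t)%g.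
Proof. by move=> fs ft x px; rewrite permM fs // ft. Qed.

Lemma fixes_aboveV p s : fixes_above p s -> fixes_above p s^-1%g.
Proof. by move=> fs x px; apply: (@perm_inj _ s); rewrite permKV fs. Qed.

Lemma fixes_above_leq p q s : p <= q -> fixes_above p s -> fixes_above q s.
Proof. by move=> le_pq fs x qx; apply: fs; apply: leq_trans qx. Qed.

(** A letter of absolute value above p is fixed, and its comparison with any letter of absolute
    value at most p depends only on its own sign. *)
Lemma flip_fixes_above p s x y : fixes_above p s -> flip s x y -> (x.2 < p) && (y.2 < p).
Proof.
move=> fs; suff sub z a : flip s z a -> z.2 < p.
  by move=> fxy; rewrite (sub _ _ fxy); rewrite flip_sym in fxy; rewrite (sub _ _ fxy).
apply: contraLR; rewrite -leqNgt /flip => pz; rewrite (fs z) //.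
case: (ltnP a.2 p) => pt; last by rewrite fs // addbb.
have := fixes_above_lt a fs; rewrite pt.
move=> pst; have lt_tz := leq_trans pt pz; have lt_stz := leq_trans pst pz.
rewrite /slt; by case: (z.1); case: (a.1); case: ((s a).1); lia.
Qed.

(** Inversions of [s] involve only letters that [v] negates, so [v] undoes all of them and the
    correction sum of [inv4M] is [inv4 s]. *)
Lemma cox_length_mul_negation p s v :
  s \in signed_perms n -> v \in signed_perms n -> fixes_above p s ->
  (forall x, x.2 < p -> v x = sopp x) ->
  cox_length (s * v) + cox_length s = cox_length v.
Proof.
move=> Ss Sv fs vN; have := inv4M v Ss.
rewrite (eq_bigr (fun z => pair_weight z * flip s z.1 z.2)); last first.
  move=> [x y] _ /=; congr (_ * nat_of_bool _); case fxy: (flip s x y) => //=.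
  have /andP[px py] := flip_fixes_above fs fxy.
  rewrite /flip !vN ?fixes_above_lt // slt_sopp (@slt_neq (s x)); last first.
    by rewrite (inj_eq perm_inj); apply/eqP => xy; rewrite xy /flip !sltxx in fxy.
  by rewrite addbN addbb.
rewrite -/(inv4 s) !inv4_cox_length ?signed_permM //; lia.
Qed.

(** Inversions of [s] stay in the range where [u] preserves order, so the correction sum of [inv4M]
    vanishes. *)
Lemma cox_length_mul_increasing p s u :
  s \in signed_perms n -> u \in signed_perms n -> fixes_above p s ->
  increasing_below p u ->
  cox_length (s * u) = cox_length s + cox_length u.
Proof.
move=> Ss Su fs incu; have := inv4M u Ss.
rewrite big1 => [|[x y] _ /=].
  rewrite !inv4_cox_length ?signed_permM //; lia.
case fxy: (flip s x y) => //=; last by rewrite muln0.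
have /andP[px py] := flip_fixes_above fs fxy.
by rewrite /flip incu ?fixes_above_lt // addbb muln0.
Qed.

(** * The elements tau_k as rotations of a cyclic order *)

Lemma tau0 : tau n 0 = 1%g.
Proof. by rewrite /tau big1. Qed.

Lemma tauS (i : 'I_n) : tau n i.+1 = (tau n i * cox_gen i)%g.
Proof.
(* The generators are extended by 1 to all natural indices, so that the range of the product can be
   widened from k to n. *)
pose F j := odflt 1%g (omap (@cox_gen n) (insub j)).
have FE (j : 'I_n) : cox_gen j = F j by rewrite /F valK.
have tauE k : k <= n -> tau n k = (\prod_(j < k) F j)%g.
  by move=> le_kn; rewrite (big_ord_widen n F le_kn); apply: eq_bigr => j _; exact: FE.
by rewrite !tauE ?ltn_ord // ?big_ord_recr ?FE // ltnW.
Qed.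

Lemma tau_signed k : tau n k \in signed_perms n.
Proof. by apply: prod_signed => i _; apply: cox_gen_signed. Qed.

(** The factor s_0 acts first and negates the letter 1; the later factors carry it up to position k
    - 1, each moving the letter it passes down by one. *)
Lemma tauE k x : k <= n ->
  (tau n k x).1 = x.1 (+) ((0 < k) && (x.2 == 0 :> nat)) /\
  (tau n k x).2 = (if x.2 < k then if x.2 == 0 :> nat then k.-1 else x.2.-1
                   else x.2 : nat) :> nat.
Proof.
elim: k => [|k IHk] lt_kn; first by rewrite tau0 perm1 addbF.
have [IH1 IH2] := IHk (ltnW lt_kn).
rewrite (tauS (Ordinal lt_kn)) permM cox_gen1 cox_gen2 /= IH1 IH2.
move: (nat_of_ord x.2) => j; split.
  by case: (k =P 0) => ?; case: (j =P 0) => ?; case: (ltnP j k) => ?;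
    case: (x.1) => /=; try case: eqP => ? /=; lia.
by case: (k =P 0) => ?; case: (j =P 0) => ?; case: (ltnP j k) => ?;
  case: (ltnP j k.+1) => ? //=; do ?case: eqP => ? //; lia.
Qed.

Lemma tau_fixes_above k : k <= n -> fixes_above k (tau n k).
Proof.
move=> le_kn x kx; have [E1 E2] := tauE x le_kn.
apply: spointP; rewrite ?E1 ?E2; last by rewrite ltnNge kx.
by case: k kx {le_kn E1 E2} => [|k] kx; rewrite ?addbF // (gtn_eqF (leq_trans _ kx)) ?addbF.
Qed.

(** In j <= k steps a letter passes position 0 at most once, so its sign changes at most once. For j
    = k every letter in range makes exactly half a turn. *)
Lemma tau_exp k j x : k <= n -> j <= k -> x.2 < k ->
  ((tau n k ^+ j)%g x).1 = x.1 (+) (x.2 < j) /\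
  ((tau n k ^+ j)%g x).2 = (if x.2 < j then x.2 + k - j else x.2 - j) :> nat.
Proof.
move=> le_kn; elim: j => [|j IHj] lt_jk lt_xk.
  by rewrite expg0 perm1 ltn0 addbF subn0.
have [IH1 IH2] := IHj (ltnW lt_jk) lt_xk.
have [E1 E2] := tauE ((tau n k ^+ j)%g x) le_kn.
rewrite expgSr permM E1 E2 IH1 IH2.
move: (nat_of_ord x.2) lt_xk => i lt_ik; split.
  rewrite -addbA; congr (_ (+) _).
  by case: (ltnP i j) => ?; case: (ltnP i j.+1) => ?; rewrite (_ : 0 < k) /=; lia.
by case: (ltnP i j) => ?; case: (ltnP i j.+1) => ?;
  do ?case: ifP => ? //; lia.
Qed.

Lemma tau_exp_negation k x : k <= n -> x.2 < k -> (tau n k ^+ k)%g x = sopp x.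
Proof.
move=> le_kn lt_xk; have [E1 E2] := tau_exp le_kn (leqnn k) lt_xk.
by apply: spointP; rewrite ?E1 ?E2 lt_xk ?addbT // addnK.
Qed.

(* For |x| != |y| this says that x, y, -x, -y occur in this order in the
   cyclic order 1, 2, ..., n, -1, -2, ..., -n; tau_k rotates the analogous
   cyclic order on the letters of absolute value at most k. *)
Definition cyc x y := (x.1 == y.1) == (x.2 < y.2).

Definition cyc_stable k s :=
  fixes_above k s /\
  forall x y, x.2 < k -> y.2 < k -> cyc (s x) (s y) = cyc x y.

Lemma cyc_stable1 k : cyc_stable k 1%g.
Proof. by split=> [x|x y] *; rewrite !perm1. Qed.

Lemma cyc_stableM k s t : cyc_stable k s -> cyc_stable k t -> cyc_stable k (s * t)%g.
Proof.
move=> [fs Cs] [ft Ct]; split=> [|x y kx ky]; first exact: fixes_aboveM.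
by rewrite !permM Ct ?Cs ?fixes_above_lt.
Qed.

Lemma cyc_stableV k s : cyc_stable k s -> cyc_stable k s^-1%g.
Proof.
move=> [fs Cs]; have fV := fixes_aboveV fs; split=> // x y kx ky.
by rewrite -Cs ?fixes_above_lt // !permKV.
Qed.

Lemma cyc_stable_expgz k s m : cyc_stable k s -> cyc_stable k (expgz s m).
Proof.
have cycX j : cyc_stable k s -> cyc_stable k (s ^+ j)%g.
  move=> Cs; elim: j => [|j IHj]; first exact: cyc_stable1.
  by rewrite expgS; apply: cyc_stableM.
case: m => j Cs; first exact: cycX.
by apply: cyc_stableV; apply: cycX.
Qed.

Lemma tau_cyc_stable k : k <= n -> cyc_stable k (tau n k).
Proof.
move=> le_kn; split=> [|x y kx ky]; first exact: tau_fixes_above.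
have [x1 x2] := tauE x le_kn; have [y1 y2] := tauE y le_kn.
rewrite /cyc x1 x2 y1 y2 kx ky; have k_gt0 : 0 < k by apply: leq_ltn_trans kx.
rewrite k_gt0 /=; move: (nat_of_ord x.2) (nat_of_ord y.2) kx ky => i j ki kj.
by case: (x.1); case: (y.1); case: (i =P 0) => ?; case: (j =P 0) => ? /=; lia.
Qed.

(** Each nontrivial factor rotates a range containing both current letters, and increasing
    subscripts ensure that later ranges contain it. *)
Lemma cyc_prod_tau (e : 'I_n -> int) (w : seq 'I_n) p x y :
  sorted (relpre val ltn) w ->
  (forall k, k \in w -> e k <> 0%R -> p <= k.+1) ->
  x.2 < p -> y.2 < p ->
  cyc ((\prod_(k <- w) expgz (tau n k.+1) (e k))%g x)
      ((\prod_(k <- w) expgz (tau n k.+1) (e k))%g y) = cyc x y.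
Proof.
elim: w p x y => [|k w IHw] p x y; first by rewrite big_nil !perm1.
move=> sorted_kw ge_p px py; rewrite big_cons !permM.
have sorted_w : sorted (relpre val ltn) w by apply: path_sorted sorted_kw.
case: (eqVneq (e k) 0%R) => [->|/eqP ek].
  rewrite !perm1; apply: (IHw p) => // j jw; apply: ge_p; exact: mem_behead.
have [fk Ck] := cyc_stable_expgz (e k) (tau_cyc_stable (ltn_ord k)).
have pk : p <= k.+1 by apply: ge_p; rewrite ?mem_head.
have [xk yk] : x.2 < k.+1 /\ y.2 < k.+1 by split; apply: leq_trans pk.
(* The bound rises from [p] to [k.+1]: the images are only known to lie in the range of
   tau_(k+1). *)
rewrite (IHw k.+1) ?fixes_above_lt ?Ck // => j jw _.
have trans : transitive (relpre val ltn : rel 'I_n) by move=> ? ? ?; apply: ltn_trans.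
by have /allP/(_ j jw) := order_path_min trans sorted_kw => /= /ltnW.
Qed.

(** * Factors of a uv-presentation and the induction *)

Lemma dotS_signed u : u \in dotS n -> u \in signed_perms n.
Proof.
case/gen_prodgP=> m [c Sc ->]; apply: prod_signed => j _.
by case/imsetP: (Sc j) => i _ ->; apply: cox_gen_signed.
Qed.

Lemma dotS_sign u x : u \in dotS n -> (u x).1 = x.1.
Proof.
case/gen_prodgP=> m [c Sc ->].
apply: (big_ind (fun s : {perm spoint n} => forall x, (s x).1 = x.1)) => [y|s t Hs Ht y|j _ y].
- by rewrite perm1.
- by rewrite permM Ht Hs.
case/imsetP: (Sc j) => i; rewrite inE => i_gt0 ->.
by rewrite cox_gen1 gtn_eqF // addbF.
Qed.

Lemma dotS_increasing_below p u e :
  u \in dotS n -> is_OGS u e -> (forall m, OGS_subscript e m -> p <= m) ->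
  increasing_below p u.
Proof.
move=> Du [_ u_def] ge_p x y px py.
have sorted_I : sorted (relpre val ltn) (index_enum 'I_n).
  by rewrite -sorted_map [index_enum _]unlock -enumT val_enum_ord iota_ltn_sorted.
have cycu (z a : spoint n) : z.2 < p -> a.2 < p -> cyc (u z) (u a) = cyc z a.
  move=> pz pt; rewrite u_def (cyc_prod_tau sorted_I _ pz pt) // => k _ ek.
  by apply: ge_p; exists k.
(* As [u] preserves signs, one instance settles two positive letters and the swapped one two
   negative letters; for opposite signs the signs decide. *)
have := cycu _ _ px py; have := cycu _ _ py px.
rewrite /cyc /slt !dotS_sign //.
by case: (x.1); case: (y.1) => //=; do ?case: ltnP => ? //=; lia.
Qed.

Lemma OGS_fixes_above p u e :
  is_OGS u e -> (forall m, OGS_subscript e m -> m <= p) -> fixes_above p u.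
Proof.
move=> [_ ->] le_p; apply: big_ind => [||k _].
- exact: fixes_above1.
- exact: fixes_aboveM.
case: (eqVneq (e k) 0%R) => [->|/eqP ek]; first exact: fixes_above1.
have [fk _] := cyc_stable_expgz (e k) (tau_cyc_stable (ltn_ord k)).
by apply: fixes_above_leq fk; apply: le_p; exists k.
Qed.

(** Induction over the prefixes ending in [u m.+1]. The second conclusion is the invariant placing a
    prefix in the subgroup whose letters the next [v] negates. *)
Lemma uv_partial_product pi r u v p : is_uv_presentation pi r u v p ->
  forall m, m < r ->
  let s := ((\prod_(1 <= j < m.+1) (u j * v j)) * u m.+1)%g in
  [/\ s \in signed_perms n,
      m.+1 < r -> fixes_above (p m.+1) s
    & ((cox_length s)%:Z =
        \sum_(1 <= j < m.+2) (-1) ^+ (m.+1 - j) * (cox_length (u j))%:Z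
        + \sum_(1 <= j < m.+1) (-1) ^+ (m - j) * (cox_length (v j))%:Z)%R].
Proof.
move=> [r_gt0 _ Du [Dv lt_p] Ou].
have fu j : 1 <= j < r -> fixes_above (p j) (u j).
  case/andP=> j0 jr; have [|->|[e eu sub_e]] := Ou j; first by rewrite j0 ltnW.
    exact: fixes_above1.
  by apply: OGS_fixes_above eu _ => k /sub_e[_]; apply.
have incu j : 1 <= j < r -> increasing_below (p j) (u j.+1).
  case/andP=> j0 jr; have [|->|[e eu sub_e]] := Ou j.+1; first by rewrite jr.
    by move=> x y _ _; rewrite !perm1.
  by apply: dotS_increasing_below eu _ => [|k /sub_e[+ _]]; [exact: Du | apply].
elim=> [|m IHm] lt_mr s.
  have -> : s = u 1 by rewrite /s big_geq ?mul1g.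
  rewrite big_nat1 (@big_geq _ _ _ 1) // addr0 subnn expr0 mul1r; split=> //.
    exact/dotS_signed/Du.
  by move=> r1; apply: fu.
have [Ss fs len_s] := IHm (ltnW lt_mr); have {}fs := fs lt_mr.
move: Ss fs len_s; set t := (_ * u m.+1)%g => St ft len_t.
have s_def : s = (t * v m.+1 * u m.+2)%g.
  by rewrite /s big_nat_recr //= /t !mulgA.
have [/andP[p0 pn] v_def] : 1 <= p m.+1 <= n /\ v m.+1 = (tau n (p m.+1) ^+ p m.+1)%g.
  exact: Dv.
have Sv : v m.+1 \in signed_perms n.
  rewrite v_def; elim: {2}(p m.+1) => [|k IHk]; first exact: signed_perm1.
  by rewrite expgSr signed_permM ?tau_signed.
have fv : fixes_above (p m.+1) (v m.+1).
  rewrite v_def; elim: {3}(p m.+1) => [|k IHk]; first exact: fixes_above1.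
  by rewrite expgSr; apply: fixes_aboveM IHk _; apply: tau_fixes_above.
have Su : u m.+2 \in signed_perms n by apply/dotS_signed/Du.
have Stv := signed_permM St Sv; have ftv := fixes_aboveM ft fv.
split; first by rewrite s_def signed_permM.
  move=> lt_r; rewrite s_def; apply: fixes_aboveM; last by apply: fu.
  by apply: fixes_above_leq ftv; rewrite ltnW // lt_p.
have len_tv : cox_length (t * v m.+1) + cox_length t = cox_length (v m.+1).
  apply: cox_length_mul_negation ft _ => // x px.
  by rewrite v_def tau_exp_negation.
have len_tvu := cox_length_mul_increasing Stv Su ftv (incu m.+1 lt_mr).
have -> : ((cox_length s)%:Z =
    (cox_length (u m.+2))%:Z + (cox_length (v m.+1))%:Z - (cox_length t)%:Z)%R.
  rewrite s_def len_tvu -len_tv; lia.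
(* Appending a term to an alternating sum reverses the signs of the earlier ones, which matches the
   minus sign of the prefix length. *)
have alt (k : nat) (f : nat -> int) :
    (\sum_(1 <= j < k.+2) (-1) ^+ (k.+1 - j) * f j =
     f k.+1 - \sum_(1 <= j < k.+1) (-1) ^+ (k - j) * f j)%R.
  rewrite big_nat_recr //= subnn expr0 mul1r addrC -sumrN; congr (_ + _)%R.
  apply: eq_big_nat => j /andP[_ jk].
  by rewrite subSn // exprS mulN1r mulNr.
rewrite (alt m.+1 (fun j => Posz (cox_length (u j)))) (alt m (fun j => Posz (cox_length (v j)))).
by rewrite len_t; ring.
Qed.

End SignedPoints.

Local Open Scope ring_scope.

Theorem theorem5p0p3 (n : nat) (pi : {perm spoint n}) (r : nat)
    (u v : nat -> {perm spoint n}) (p : nat -> nat)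
    (Bpi : pi \in signed_perms n)
    (uv_pi : is_uv_presentation pi r u v p) :
  (cox_length pi)%:Z =
    \sum_(1 <= j < r.+1) (-1) ^+ (r - j) * (cox_length (u j))%:Z
    + \sum_(1 <= j < r) (-1) ^+ (r - 1 - j) * (cox_length (v j))%:Z.
Proof.
have [r_gt0 pi_def _ _ _] := uv_pi.
case: r r_gt0 uv_pi pi_def => // r _ uv_pi pi_def.
have [_ _] := uv_partial_product uv_pi (ltnSn r).
by rewrite -pi_def subSS subn0.
Qed.
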